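(* Every connected unicyclic graph that is not König–Egerváry can be constructed (up to isomorphism) by the following procedure. Procedure: (1) Construct an odd cycle and color its vertices blue. (2) Either perform step (3), or perform step (4), or stop. (3) Choose any existing vertex $u$, add two new vertices $u_1,u_2$ and edges $uu_1, u_1u_2$; color $u_1$ red and $u_2$ black; go to (2). (4) If there is no red vertex go to (2); otherwise choose a red vertex $u$, add a new vertex $u_1$ and the edge $uu_1$, color $u_1$ black; go to (2).
   Context: All graphs are finite and simple. $\alpha(G)$ is the maximum size of an independent set and $\mu(G)$ the maximum size of a matching. $G$ is König–Egerváry if $\alpha(G)+\mu(G)=|V(G)|$. A graph is unicyclic if it contains exactly one cycle. *)

(* Defs.v *)
From mathcomp Require Import all_boot.
Set Implicit Arguments.
Unset Strict Implicit.
Unset Printing Implicit Defensive.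

Record sgraph := SGraph {
  vertex :> finType;
  edge_rel : rel vertex;
  edge_rel_sym : symmetric edge_rel;
  edge_rel_irr : irreflexive edge_rel }.

Notation "x -- y" := (edge_rel x y) (at level 30, no associativity).

Section GraphNotions.
Variable G : sgraph.

Definition edges : {set {set G}} := [set [set x; y] | x in G, y in G & x -- y].

Definition independent (S : {set G}) : bool :=
  [forall x in S, forall y in S, ~~ (x -- y)].

Definition alpha : nat := \max_(S : {set G} | independent S) #|S|.

Definition matching (M : {set {set G}}) : bool :=
  (M \subset edges) && trivIset M.

Definition mu : nat := \max_(M : {set {set G}} | matching M) #|M|.

Definition konig_egervary : Prop := alpha + mu = #|G|.

Definition connected_graph : Prop := forall x y : G, connect (@edge_rel G) x y.

(* A cycle, as a subgraph, is determined by its edge set: all rotations and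
   reversals of a cyclic vertex sequence give the same set of edges. *)
Definition is_cycle (F : {set {set G}}) : Prop :=
  exists s : seq G,
    [/\ 2 < size s, ucycle (@edge_rel G) s &
        F = [set [set x; next s x] | x in s]].

Definition unicyclic : Prop := exists! F : {set {set G}}, is_cycle F.

End GraphNotions.

Definition isomorphic (G H : sgraph) : Prop :=
  exists2 f : G -> H, bijective f & {mono f : x y / x -- y}.

Section CycleGraph.
Variable n : nat.

(* The conjunct [i != j] only matters for the degenerate case n = 1. *)
Definition cycle_rel : rel 'I_n :=
  fun i j => (i != j) && ((j == ordS i) || (i == ordS j)).

Lemma cycle_rel_sym : symmetric cycle_rel.
Proof. by move=> i j; rewrite /cycle_rel eq_sym orbC. Qed.

Lemma cycle_rel_irr : irreflexive cycle_rel.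
Proof. by move=> i; rewrite /cycle_rel eqxx. Qed.

Definition cycle_graph : sgraph := SGraph cycle_rel_sym cycle_rel_irr.

End CycleGraph.

Section AddPendant.
Variables (G : sgraph) (u : G).

(* The new vertex is [None]; its only neighbour is [Some u]. *)
Definition pendant_rel : rel (option G) := fun a b =>
  match a, b with
  | Some x, Some y => x -- y
  | Some x, None | None, Some x => x == u
  | None, None => false
  end.

Lemma pendant_rel_sym : symmetric pendant_rel.
Proof. by move=> [x|] [y|] //=; apply: edge_rel_sym. Qed.

Lemma pendant_rel_irr : irreflexive pendant_rel.
Proof. by move=> [x|] //=; apply: edge_rel_irr. Qed.

Definition add_pendant : sgraph := SGraph pendant_rel_sym pendant_rel_irr.

End AddPendant.

Inductive color := Blue | Red | Black.

Record cgraph := CGraph { graph_of :> sgraph; vcolor : graph_of -> color }.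

Definition add_colored_pendant (H : cgraph) (u : H) (c : color) : cgraph :=
  @CGraph (add_pendant u)
    (fun a : option H => if a is Some x then vcolor x else c).

(* The colored graphs present at some visit of step (2) of the procedure.
   In [step_path], u1 is the vertex added first, and u2 is attached to
   [None], which is u1. *)
Inductive constructed : cgraph -> Prop :=
| step_cycle (n : nat) : 2 < n -> odd n ->
    constructed (@CGraph (cycle_graph n) (fun=> Blue))
| step_path (H : cgraph) (u : H) : constructed H ->
    constructed (@add_colored_pendant (add_colored_pendant u Red) None Black)
| step_no_red (H : cgraph) : constructed H ->
    (forall u : H, vcolor u <> Red) -> constructed H
| step_leaf (H : cgraph) (u : H) : constructed H -> vcolor u = Red ->
    constructed (add_colored_pendant u Black).

(* Main.v *)
(* Let c be the cycle of G and let S be a set of vertices containing c whose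
   induced subgraph is connected and not König–Egerváry.  If S = c, then c is
   chordless and, as even cycles are König–Egerváry, odd.  Otherwise take a
   longest path of S that starts in c and leaves it at once.  Its last vertex z
   is a leaf of S; let h be the neighbour of z.
   - If the path has a single edge, then h is on c, S - z - h is acyclic, hence
     König–Egerváry, and then so is S: contradiction.
   - If h has a neighbour off the path, then by maximality that neighbour is a
     second leaf at h; S - z is still not König–Egerváry, and z is restored by
     step (4), since a vertex adjacent to a leaf is red in a constructed graph.
   - Otherwise h has degree 2; S - z - h is not König–Egerváry, and step (3)
     restores h and z. *)

Require Import Defs.
From mathcomp Require Import all_boot.
Set Implicit Arguments.
Unset Strict Implicit.
Unset Printing Implicit Defensive.

(** * Longest sequences, successors in a sequence, and arithmetic modulo [n] *)

(** Tuples of a fixed length form a finite type, so it is decidable which lengths occur, and a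
    bounded set of lengths has a maximum. *)
Lemma ex_longest_seq (T : finType) (P : pred (seq T)) (n : nat) (s0 : seq T) :
  P s0 -> (forall s, P s -> size s <= n) ->
  exists2 s, P s & forall s', P s' -> size s' <= size s.
Proof.
move=> Ps0 bnd; pose Q k := [exists t : k.-tuple T, P t].
have exQ : exists k, Q k.
  by exists (size s0); apply/existsP; exists (in_tuple s0).
have bndQ k : Q k -> k <= n.
  by case/existsP=> t /bnd; rewrite size_tuple.
case: (ex_maxnP exQ bndQ) => k /existsP[t Pt] maxk.
exists t => // s' Ps'; rewrite size_tuple; apply: maxk.
by apply/existsP; exists (in_tuple s').
Qed.

Lemma next_nth_mod (T : eqType) (x0 : T) (s : seq T) (i : nat) :
  uniq s -> i < size s -> next s (nth x0 s i) = nth x0 s (i.+1 %% size s).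
Proof.
move=> un lti; rewrite next_nth mem_nth // index_uniq //.
case: s un lti => // y s un; rewrite ltnS leq_eqVlt => /predU1P[->|lti].
  (* At the last index [nth] runs off the tail and returns its default [y], the head of the
     sequence. *)
  by rewrite modnn nth_default.
by rewrite modn_small //=; apply: set_nth_default.
Qed.

Lemma ordS_neq (n : nat) (i : 'I_n) : 1 < n -> ordS i != i.
Proof.
move=> n1; rewrite -val_eqE /=; have := ltn_ord i.
rewrite leq_eqVlt => /predU1P[E|lt]; last by rewrite modn_small // gtn_eqF.
by rewrite E modnn; apply: contraTneq n1 => i0; rewrite -E -i0.
Qed.

Lemma ordS2_neq (n : nat) (i : 'I_n) : 2 < n -> ordS (ordS i) != i.
Proof.
move=> n2; rewrite -val_eqE /=; have := ltn_ord i.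
rewrite leq_eqVlt => /predU1P[E|lt].
  rewrite E modnn modn_small ?(ltn_trans _ n2) //.
  by apply: contraTneq n2 => i1; rewrite -E -i1.
rewrite (modn_small lt); move: lt; rewrite leq_eqVlt => /predU1P[E|lt].
  by rewrite E modnn; apply: contraTneq n2 => i0; rewrite -E -i0.
by rewrite modn_small // gtn_eqF // ltnW.
Qed.

(** * Colors in constructed graphs *)

(** An invariant of the procedure: both alternatives survive the addition of vertices. It forces the
    neighbour of a leaf to be red, since a leaf excludes the second alternative. *)
Lemma constructed_neighbours (H : cgraph) (x : H) : constructed H ->
  (vcolor x = Black /\ exists2 r, x -- r & vcolor r = Red) \/
  (exists a b, [/\ a != b, x -- a & x -- b]).
Proof.
move=> cH; elim: cH x => {H} [n n2 nodd i|H u _ IH x|H _ IH _ x|H u _ IH uR x].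
- right; exists (ordS i), (ord_pred i); split.
  + by apply: contra (ordS2_neq i n2) => /eqP->; rewrite ord_predK.
  + by rewrite /= /cycle_rel eqxx eq_sym ordS_neq // ltnW.
  + rewrite /= /cycle_rel ord_predK eqxx orbT andbT.
    by rewrite -{1}(ord_predK i) ordS_neq // ltnW.
- case: x => [[x|]|] /=.
  + case: (IH x) => [[xB [r xr rR]]|[a [b [ab xa xb]]]].
      by left; split=> //; exists (Some (Some r)).
    by right; exists (Some (Some a)), (Some (Some b)).
  + by right; exists None, (Some (Some u)); rewrite /= eqxx.
  + by left; split=> //; exists (Some None); rewrite /= ?eqxx.
- exact: IH.
- case: x => [x|] /=.
    case: (IH x) => [[xB [r xr rR]]|[a [b [ab xa xb]]]].
      by left; split=> //; exists (Some r).
    by right; exists (Some a), (Some b).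
  by left; split=> //; exists (Some u); rewrite /= ?eqxx.
Qed.

Lemma constructed_leaf_red (H : cgraph) (x r : H) : constructed H ->
  x -- r -> (forall z, x -- z -> z = r) -> vcolor r = Red.
Proof.
move=> cH xr lf; case: (constructed_neighbours x cH).
  by case=> _ [r' /lf ->].
by case=> a [b [/eqP ab /lf Ea /lf Eb]]; case: ab; rewrite Ea Eb.
Qed.

(** * The König-Egerváry property of vertex sets *)

Section Graph.
Variable G : sgraph.
Implicit Types (S I : {set G}) (M : {set {set G}}) (x y z u v w : G).
Implicit Types (s c p q : seq G).

Local Notation adj := (@edge_rel G).

Lemma adj_neq x y : x -- y -> x != y.
Proof. by apply: contraTneq => ->; rewrite edge_rel_irr. Qed.

(** Each edge of [M] has an end outside [I]. Choosing one such end per edge is injective, as the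
    edges are disjoint, so [M] is no larger than the complement of [I]. *)
Lemma independent_leq I M : independent I -> matching M -> #|I| + #|M| <= #|G|.
Proof.
move=> indI /andP[subM trivM].
have exF e : e \in M -> exists2 x, x \in e & x \notin I.
  move=> /(subsetP subM) /imset2P[x y _]; rewrite inE => /andP[_ xy] ->.
  have [xI|] := boolP (x \in I); last by exists x; rewrite // !inE eqxx.
  exists y; first by rewrite !inE eqxx orbT.
  by apply: contraL xy => yI; move/forall_inP/(_ _ xI)/forall_inP: indI; apply.
pose F (e : {set G}) := [pick x in e | x \notin I].
have FP e : e \in M -> exists2 x, F e = Some x & (x \in e) && (x \notin I).
  move=> /exF[x xe xI]; rewrite /F; case: pickP => [y|/(_ x)]; first by exists y.
  by rewrite xe xI.
have injF : {in M &, injective F}.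
  move=> e1 e2 e1M e2M.
  have [x -> /andP[xe1 _]] := FP _ e1M; have [y -> /andP[ye2 _]] := FP _ e2M.
  case=> xy; rewrite -{y}xy in ye2.
  by rewrite -(def_pblock trivM e1M xe1) (def_pblock trivM e2M ye2).
rewrite -(card_in_imset injF) -(cardsC I) leq_add2l.
rewrite -(card_imset (mem (~: I)) Some_inj); apply: subset_leq_card.
apply/subsetP=> _ /imsetP[e /FP[x -> /andP[_ xI]] ->].
by rewrite imset_f // inE.
Qed.

(* By [independent_leq], for [S = setT] this is equivalent to
   [konig_egervary G]; witnesses are what the induction transports. *)
Definition ke_on S := exists I M,
  [/\ I \subset S, independent I, matching M, cover M \subset S
    & #|S| <= #|I| + #|M|].

Lemma ke_onT : ke_on [set: G] -> konig_egervary G.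
Proof.
case=> I [M [_ indI matM _]]; rewrite cardsT => le.
have [I' indI' aE] := @eq_bigmax_cond _ (@independent G) (fun S => #|S|)
  (introT card_gt0P (ex_intro _ I indI)).
have [M' matM' mE] := @eq_bigmax_cond _ (@matching G) (fun M => #|M|)
  (introT card_gt0P (ex_intro _ M matM)).
rewrite /konig_egervary; apply/eqP; rewrite eqn_leq; apply/andP; split.
  by rewrite /alpha /mu aE mE; apply: independent_leq.
apply: (leq_trans le); apply: leq_add.
  exact: (@leq_bigmax_cond _ (@independent G) (fun S => #|S|)).
exact: (@leq_bigmax_cond _ (@matching G) (fun M => #|M|)).
Qed.

Lemma independent_setU1 I S v : independent I -> I \subset S ->
  (forall w, w \in I -> ~~ (v -- w)) -> independent (v |: I).
Proof.
move=> indI IS nv; apply/forall_inP=> x; rewrite in_setU1 => xI.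
apply/forall_inP=> y; rewrite in_setU1 => yI.
case/predU1P: xI yI => [->|xI] /predU1P[->|yI].
- by rewrite edge_rel_irr.
- exact: nv.
- by rewrite edge_rel_sym; apply: nv.
- by move/forall_inP/(_ _ xI)/forall_inP: indI; apply.
Qed.

Definition leaf_on S v u :=
  [/\ v \in S, u \in S, v -- u & forall w, w \in S -> v -- w -> w = u].

Lemma ke_on_isolated S v : v \in S -> (forall w, w \in S -> ~~ (v -- w)) ->
  ke_on (S :\ v) -> ke_on S.
Proof.
move=> vS iso [I [M [IS indI matM MS le]]].
have vI : v \notin I by apply/negP=> /(subsetP IS); rewrite !inE eqxx.
have IS' : I \subset S := subset_trans IS (subsetDl _ _).
exists (v |: I), M; split=> //.
- by rewrite subUset sub1set vS.
- by apply: (independent_setU1 indI IS') => w /(subsetP IS'); apply: iso.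
- exact: subset_trans MS (subsetDl _ _).
- by rewrite (cardsD1 v S) vS cardsU1 vI -addnA leq_add2l.
Qed.

(** The leaf [v] joins the independent set and the edge [vu] joins the matching, which pays for the
    two vertices restored. *)
Lemma ke_on_leaf S v u : leaf_on S v u -> ke_on (S :\ v :\ u) -> ke_on S.
Proof.
case=> vS uS vu lf [I [M [IS indI matM MS le]]].
have uv : u != v by rewrite eq_sym adj_neq.
have vI : v \notin I by apply/negP=> /(subsetP IS); rewrite !inE eqxx andbF.
have uI : u \notin I by apply/negP=> /(subsetP IS); rewrite !inE eqxx.
have subS : S :\ v :\ u \subset S by apply/subsetP=> x; rewrite !inE => /and3P[].
have IS' := subset_trans IS subS; have MS' := subset_trans MS subS.
have disj : {in M, forall e : {set G}, [disjoint [set v; u] & e]}.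
  move=> e eM; rewrite disjoint_subset; apply/subsetP=> x xvu; rewrite inE.
  apply: contraL xvu => xe.
  have: x \in S :\ v :\ u by apply: (subsetP MS); apply/bigcupP; exists e.
  by rewrite !inE => /and3P[/negPf-> /negPf->].
have eM : [set v; u] \notin M.
  apply/negP=> /disj; rewrite -setI_eq0 setIid => /eqP/setP/(_ v).
  by rewrite !inE eqxx.
exists (v |: I), ([set v; u] |: M); split.
- by rewrite subUset sub1set vS.
- apply: (independent_setU1 indI IS') => w wI.
  by apply: contra uI => /(lf _ (subsetP IS' _ wI)) <-.
- case/andP: matM => edM trM; apply/andP; split.
    rewrite subUset edM andbT sub1set; apply/imset2P.
    by exists v u => //; rewrite inE.
  rewrite /trivIset; apply/trivIsetP=> A B; rewrite !in_setU1.
  move=> /predU1P[->|AM] /predU1P[->|BM]; rewrite ?eqxx // => AB.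
  + exact: disj.
  + by rewrite disjoint_sym; apply: disj.
  + by move/trivIsetP: trM; apply.
- by rewrite /cover bigcup_setU big_set1 subUset MS' subUset !sub1set vS uS.
- rewrite (cardsD1 v S) vS (cardsD1 u (S :\ v)) !inE uv uS /=.
  by rewrite !cardsU1 vI eM addnACA addnA leq_add2l.
Qed.

(** If the independent set contains [u], trade [u] for the leaf [w], which keeps its size. With [u]
    absent, [v] can be added, and this pays for the vertex restored. *)
Lemma ke_on_twin_leaf S v w u : v != w -> leaf_on S v u -> leaf_on S w u ->
  ke_on (S :\ v) -> ke_on S.
Proof.
move=> vw [vS uS vu lfv] [wS _ wu lfw] [I [M [IS indI matM MS le]]].
have IS' : I \subset S := subset_trans IS (subsetDl _ _).
have vI : v \notin I by apply/negP=> /(subsetP IS); rewrite !inE eqxx.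
pose J := if u \in I then w |: (I :\ u) else I.
have JS : J \subset S.
  rewrite /J; case: ifP => // _; rewrite subUset sub1set wS.
  exact: subset_trans (subsetDl _ _) IS'.
have uJ : u \notin J.
  rewrite /J; case: ifP => [_|->//]; rewrite !inE eqxx /= orbF.
  by rewrite eq_sym adj_neq.
have vJ : v \notin J.
  by rewrite /J; case: ifP => // _; rewrite !inE (negPf vI) andbF orbF.
have cJ : #|I| <= #|J|.
  rewrite /J; case: ifP => // uI; rewrite (cardsD1 u I) uI cardsU1 leq_add2r.
  suff -> : w \notin I :\ u by [].
  rewrite !inE; apply/andP=> -[_ wI].
  by move/forall_inP/(_ _ wI)/forall_inP/(_ _ uI): indI; rewrite wu.
have indJ : independent J.
  rewrite /J; case: ifP => // uI; have IuI : I :\ u \subset I := subsetDl _ _.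
  have indIu : independent (I :\ u).
    apply/forall_inP=> x /(subsetP IuI) xI; apply/forall_inP=> y /(subsetP IuI) yI.
    by move/forall_inP/(_ _ xI)/forall_inP: indI; apply.
  apply: (independent_setU1 indIu IuI) => x; rewrite !inE => /andP[xu xI].
  by apply: contra xu => /(lfw _ (subsetP IS' _ xI)) ->.
exists (v |: J), M; split=> //.
- by rewrite subUset sub1set vS.
- apply: (independent_setU1 indJ JS) => x xJ.
  by apply: contra uJ => /(lfv _ (subsetP JS _ xJ)) <-.
- exact: subset_trans MS (subsetDl _ _).
- rewrite (cardsD1 v S) vS cardsU1 vJ -addnA leq_add2l.
  by apply: leq_trans le _; rewrite leq_add2r.
Qed.

(** * Paths, cycles and acyclic vertex sets *)

(** The edge [zw] closes the part of the path up to [w]. Giving the cycle as a prefix records which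
    vertices of the path it omits. *)
Lemma chord_cycle z h p w :
  path adj z (h :: p) -> uniq [:: z, h & p] -> z -- w -> w \in p ->
  exists s p2, [/\ [:: z, h & p] = s ++ p2, 2 < size s & ucycle adj s].
Proof.
move=> pth un zw /splitPr wp; case: wp pth un => p1 p2 pth un.
exists [:: z, h & rcons p1 w], p2; rewrite cat_cons cat_cons cat_rcons; split=> //.
  by rewrite /= size_rcons.
have E : [:: z, h & p1 ++ w :: p2] = [:: z, h & rcons p1 w] ++ p2.
  by rewrite /= cat_rcons.
move: un; rewrite E cat_uniq => /andP[un _].
apply/andP; split=> //.
move: pth; rewrite -cat_rcons -cat_cons cat_path => /andP[pth _].
by rewrite /cycle rcons_path pth /= last_rcons edge_rel_sym.
Qed.

Lemma uniq_size_leq s : uniq s -> size s <= #|G|.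
Proof. by move/card_uniqP <-; apply: max_card. Qed.

(** Induction on the size of [S]. The first vertex of a longest path in [S] has all its neighbours
    in [S] on the path, and one beyond the second vertex would close a cycle. So it is isolated or a
    leaf, and can be removed. *)
Lemma acyclic_ke_on S :
  (forall s, 2 < size s -> ucycle adj s -> ~ {subset s <= S}) -> ke_on S.
Proof.
have [n] := ubnP #|S|; elim: n S => // n IHn S; rewrite ltnS => leSn acy.
have [->|/set0Pn[x0 x0S]] := eqVneq S set0.
  exists set0, set0; rewrite sub0set cards0 /cover big_set0; split=> //.
  - by apply/forall_inP=> x; rewrite inE.
  - rewrite /matching sub0set; apply/trivIsetP=> A B; by rewrite inE.
have IH v (T : {set G}) : v \in S -> T \subset S :\ v -> ke_on T.
  move=> vS TS; apply: IHn => [|s sz cyc sT].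
    apply: leq_trans leSn; rewrite (cardsD1 v S) vS ltnS.
    exact: subset_leq_card.
  apply: (acy s sz cyc) => x /sT /(subsetP TS).
  by rewrite inE => /andP[].
pose P s := [&& sorted adj s, uniq s & all (mem S) s].
have P0 : P [:: x0] by rewrite /P /= x0S.
have [|s Ps maxs] := ex_longest_seq P0 (n := #|G|).
  by move=> s /and3P[_ /uniq_size_leq].
case: s Ps maxs => [|z s] /and3P[pth un al] maxs.
  by have := maxs _ P0.
have zS : z \in S by case/andP: al.
have nbr w : w \in S -> z -- w -> w \in s.
  move=> wS zw; apply: contraT => ws; have := maxs (w :: z :: s).
  rewrite /= ltnn; apply; rewrite /P /= edge_rel_sym zw wS.
  move: pth un al => /= -> -> ->; rewrite inE negb_or ws andbT.
  by rewrite eq_sym adj_neq.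
case: s pth un al maxs nbr => [|h p] pth un al maxs nbr.
  apply: (@ke_on_isolated S z zS); last by apply: (IH z).
  by move=> w wS; apply/negP=> /(nbr w wS).
have hS : h \in S by case/and3P: al.
apply: (@ke_on_leaf S z h); last by apply: (IH z) => //; apply: subsetDl.
split=> //; first by case/andP: pth.
move=> w wS zw; have := nbr _ wS zw; rewrite inE => /predU1P[//|wp].
have [s [p2 [E sz cyc]]] := chord_cycle pth un zw wp.
case: (acy s sz cyc) => x xs; move/allP: al => /(_ x); apply.
by rewrite E mem_cat xs.
Qed.

Lemma cycle_has_two_neighbours c v : 2 < size c -> ucycle adj c -> v \in c ->
  exists a b, [/\ a \in c, b \in c, a != b, v -- a & v -- b].
Proof.
move=> sz cyc /rot_to[i c' E].
have {cyc}: ucycle adj (v :: c') by rewrite -E rot_ucycle.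
have memE x : x \in c = (x \in v :: c') by rewrite -E mem_rot.
have {sz}: 2 < size (v :: c') by rewrite -E size_rot.
(* With [v] rotated to the front, its neighbours are the second and the last entries. *)
case: c' E memE => [|a c'] // E memE; case/lastP: c' E memE => [|c' b] // E memE _.
case/andP; rewrite /cycle rcons_path => /andP[/andP[va _]].
rewrite last_cons last_rcons edge_rel_sym => vb /= /and3P[_ ac' _].
exists a, b; split=> //; rewrite ?memE ?inE ?eqxx ?orbT //.
  by rewrite mem_rcons in_cons eqxx !orbT.
by apply: contra ac' => /eqP->; rewrite mem_rcons inE eqxx.
Qed.

Definition cycle_edges s : {set {set G}} := [set [set x; next s x] | x in s].

(** * Embeddings and pendant vertices *)

Definition embedding (H : sgraph) (f : H -> G) S :=
  [/\ injective f, {mono f : a b / a -- b} & f @: setT = S].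

Definition pendant_extension (H : sgraph) (a : H) (f : H -> G) v
  (b : add_pendant a) : G := if b is Some b' then f b' else v.

Lemma embedding_pendant (H : sgraph) (a : H) (f : H -> G) S v :
  leaf_on S v (f a) -> embedding f (S :\ v) ->
  embedding (@pendant_extension H a f v) S.
Proof.
move=> [vS _ va lf] [fi fm fS].
have fv b : f b != v.
  have: f b \in f @: setT by apply: imset_f.
  by rewrite fS !inE => /andP[].
have fbS b : f b \in S.
  have: f b \in f @: setT by apply: imset_f.
  by rewrite fS !inE => /andP[].
have nbr b : (v -- f b) = (b == a).
  by apply/idP/eqP => [/(lf _ (fbS b))/fi|->].
split.
- case=> [b|] [b'|] //= E; first by rewrite (fi _ _ E).
    by move: (fv b); rewrite E eqxx.
  by move: (fv b'); rewrite E eqxx.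
- case=> [b|] [b'|] /=; rewrite ?fm ?edge_rel_irr //.
  by rewrite edge_rel_sym nbr.
- apply/setP=> x; apply/imsetP/idP => [[[b|] _ ->] //=|xS].
  have [->|xv] := eqVneq x v; first by exists None.
  have: x \in f @: setT by rewrite fS !inE xv.
  by case/imsetP=> b _ ->; exists (Some b).
Qed.

(** * Graphs with a unique cycle *)

Section Unicyclic.
Variable c : seq G.
Hypothesis size_c : 2 < size c.
Hypothesis cycle_c : ucycle adj c.
Hypothesis cycle_unique : forall s, 2 < size s -> ucycle adj s ->
  cycle_edges s = cycle_edges c.

(** Transfers uniqueness from edge sets, where it is assumed, to vertex sets. *)
Lemma mem_cycle_edges s x : (x \in s) = (x \in cover (cycle_edges s)).
Proof.
apply/idP/bigcupP => [xs|[_ /imsetP[y ys ->]]].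
  by exists [set x; next s x]; [apply: imset_f | rewrite !inE eqxx].
by rewrite !inE => /orP[] /eqP->; rewrite ?mem_next.
Qed.

Lemma cycle_vertices s : 2 < size s -> ucycle adj s -> s =i c.
Proof. by move=> sz cyc x; rewrite !mem_cycle_edges cycle_unique. Qed.

Lemma leaf_notin_cycle S v u : {subset c <= S} -> leaf_on S v u -> v \notin c.
Proof.
move=> cS [_ _ _ lf]; apply/negP=> vc.
have [a [b [ac bc ab va vb]]] := cycle_has_two_neighbours size_c cycle_c vc.
by case/eqP: ab; rewrite (lf _ (cS _ ac) va) (lf _ (cS _ bc) vb).
Qed.

(* A chord would close a cycle which contains [x] only if it also contains
   the vertex [y], which is not on [c]; but every cycle has the vertices
   of [c]. *)
Lemma no_back_edge q y x z h p w :
  q ++ [:: y; x] = [:: z, h & p] -> x \in c -> y \notin c ->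
  path adj z (h :: p) -> uniq [:: z, h & p] -> z -- w -> w \in h :: p -> w = h.
Proof.
move=> Lq xc yc pth un zw; rewrite inE => /predU1P[//|wp].
have [s [p2 [E sz cyc]]] := chord_cycle pth un zw wp.
have sc := cycle_vertices sz cyc.
have xs : x \in s by rewrite sc.
case/lastP: p2 E => [|p2 x'] E.
  have: y \in s ++ [::] by rewrite -E -Lq mem_cat !inE eqxx orbT.
  by rewrite cats0 sc (negPf yc).
move: E; rewrite -Lq -rcons_cat -cat1s catA cats1 => /eqP.
rewrite eqseq_rcons => /andP[/eqP E /eqP xx']; move: un.
by rewrite -Lq -cat1s catA E cats1 rcons_uniq mem_cat xs.
Qed.

(** The stretch of [c] from [x] to [y], closed by the edge [xy], is again a cycle. By uniqueness it
    has the edges of [c], so [xy] is one of them. *)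
Lemma cycle_chordless x y : x \in c -> y \in c -> x -- y ->
  y = next c x \/ x = next c y.
Proof.
move=> xc yc xy.
suff: [set x; y] \in cycle_edges c.
  case/imsetP=> a ac /setP E; have xy' := adj_neq xy.
  have /esym := E x; have /esym := E y.
  rewrite !inE !eqxx orbT /= => /orP[] /eqP Ey /orP[] /eqP Ex.
  - by rewrite Ex Ey eqxx in xy'.
  - by right; rewrite Ey.
  - by left; rewrite Ex.
  - by rewrite Ex Ey eqxx in xy'.
have [i c' E] := rot_to xc.
have cyc : ucycle adj (x :: c') by rewrite -E rot_ucycle.
have nE : next c =1 next (x :: c').
  by move=> z; rewrite -E next_rot //; case/andP: cycle_c.
have: y \in x :: c' by rewrite -E mem_rot.
rewrite inE eq_sym (negPf (adj_neq xy)) /= => yc'.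
case/splitPr: yc' cyc nE {E} => -[|h s1] s2 cyc nE.
  by apply/imsetP; exists x; rewrite // nE /= eqxx.
pose s := [:: x, h & rcons s1 y].
have cycs : ucycle adj s.
  have: ucycle adj (s ++ s2) by rewrite /s !cat_cons cat_rcons.
  rewrite /ucycle cat_uniq => /andP[pth /andP[-> _]]; rewrite andbT.
  move: pth; rewrite {1}/s !cat_cons /cycle -cat_cons rcons_cat cat_path.
  case/andP=> pth _; change (path adj x (rcons (h :: rcons s1 y) x)).
  by rewrite rcons_path pth /= last_rcons edge_rel_sym.
have ss : 2 < size s by rewrite /= size_rcons.
rewrite -(cycle_unique ss cycs); apply/imsetP; exists y.
  by rewrite !inE mem_rcons inE eqxx !orbT.
rewrite setUC; congr [set _; _].
(* The closing edge leaves the last entry [y]; rotating [y] to the front lets [next] compute to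
   [x]. *)
have -> : s = rot 1 [:: y, x & h :: s1] by rewrite /rot /= cats1.
rewrite next_rot /= ?eqxx //.
by case/andP: cycs => _; rewrite /s -!rcons_cons rcons_uniq.
Qed.

(* Connectedness of the subgraph induced by [S], relative to [c]; in this form
   it visibly survives the removal of a leaf. *)
Definition cut_connected S := forall T : {set G}, {subset c <= T} -> T \proper S ->
  exists x y, [/\ x \in T, y \in S, y \notin T & x -- y].

Lemma cut_connected_leaf S v u : leaf_on S v u -> cut_connected S ->
  cut_connected (S :\ v).
Proof.
move=> [vS uS vu lf] conS T cT /properP[TS [z zS zT]].
have vT : v \notin T by apply/negP=> /(subsetP TS); rewrite !inE eqxx.
have TS' : T \subset S := subset_trans TS (subsetDl _ _).
have [|x [y [xT yS yT xy]]] := conS T cT.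
  by apply/properP; split=> //; exists v.
have [yv|yv] := eqVneq y v; last by exists x, y; split=> //; rewrite !inE yv.
have {}xu : x = u.
  by apply: lf; [apply: (subsetP TS') | rewrite -yv edge_rel_sym].
subst x y.
(* The edge found leads to [v], so [u] is in [T]. An edge leaving [v |: T] cannot start at [v],
   whose only neighbour in [S] is [u], so it starts in [T]. *)
have [||a [b [aT bS bT ab]]] := conS (v |: T).
- by move=> a /cT aT; rewrite !inE aT orbT.
- apply/properP; split; first by rewrite subUset sub1set vS.
  by move: zS; rewrite !inE => /andP[zv zS]; exists z; rewrite // !inE negb_or zv.
move: bT; rewrite !inE negb_or => /andP[bv bT].
exists a, b; split; rewrite ?inE ?bv //.
case/setU1P: aT => // av; subst a.
by case/negP: bT; rewrite (lf b bS ab).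
Qed.

(** * Even cycles, and the isomorphism with a cycle graph *)

(** Edges within [c] join consecutive vertices, whose indices differ in parity, also at the wrap
    since the length is even. So the vertices of even index are independent, and the edges to their
    successors form a matching. *)
Lemma even_cycle_ke : ~~ odd (size c) -> ke_on [set x in c].
Proof.
move=> evc; have /andP[cyc un] := cycle_c.
pose P x := odd (index x c).
have Pnext x : x \in c -> P (next c x) = ~~ P x.
  move=> xc; rewrite /P.
  have lti : index x c < size c by rewrite index_mem.
  rewrite -{1}(nth_index x xc) next_nth_mod //.
  rewrite index_uniq ?ltn_mod ?(leq_trans _ lti) //.
  by rewrite odd_mod ?(negPf evc).
have Padj x y : x \in c -> y \in c -> x -- y -> P x = ~~ P y.
  move=> xc yc xy; have [->|->] := cycle_chordless xc yc xy.
    by rewrite Pnext // negbK.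
  by rewrite Pnext.
have nextI : {in c &, injective (next c)}.
  by move=> x y xc yc E; rewrite -(prev_next un x) E prev_next.
pose I := [set x in c | ~~ P x].
pose e x := [set x; next c x].
have eE : {in I &, forall x y z, z \in e x -> z \in e y -> x = y}.
  move=> x y; rewrite !inE => /andP[xc Px] /andP[yc Py] z.
  rewrite !inE => /orP[] /eqP-> /orP[] /eqP E //.
  - by move: Px; rewrite E Pnext ?Py.
  - by move: Py; rewrite -E Pnext ?Px.
  - exact: nextI.
exists I, [set e x | x in I]; split.
- by apply/subsetP=> x; rewrite !inE => /andP[].
- apply/forall_inP=> x; rewrite inE => /andP[xc Px].
  apply/forall_inP=> y; rewrite inE => /andP[yc Py].
  by apply: contraL Py => /(Padj _ _ xc yc) <-.
- apply/andP; split.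
    apply/subsetP=> _ /imsetP[x + ->]; rewrite inE => /andP[xc _].
    by apply/imset2P; exists x (next c x); rewrite // inE next_cycle.
  apply/trivIsetP=> _ _ /imsetP[x xI ->] /imsetP[y yI ->].
  apply: contraR => /pred0Pn[z /andP[zx zy]].
  by rewrite (eE _ _ xI yI z).
- apply/bigcupsP=> _ /imsetP[x + ->]; rewrite inE => /andP[xc _].
  by rewrite subUset !sub1set !inE mem_next xc.
- rewrite card_in_imset; last first.
    move=> x y xI yI /setP/(_ x); rewrite !inE eqxx => /esym xe.
    by apply: (eE _ _ xI yI x); rewrite !inE ?eqxx.
  (* The vertices of odd index are successors of vertices in [I], hence at most [#|I|] in number. *)
  rewrite -(cardsID I [set x in c]) leq_add //.
    exact/subset_leq_card/subsetIr.
  rewrite -(card_in_imset (f := next c) (D := mem I)); last first.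
    by move=> x y; rewrite !inE => /andP[xc _] /andP[yc _]; apply: nextI.
  apply: subset_leq_card; apply/subsetP=> x; rewrite !inE => /andP[+ xc].
  rewrite xc /= negbK => Px; apply/imsetP; exists (prev c x).
    by rewrite inE mem_prev xc /=;
       move: Px; rewrite -{1}(next_prev un x) Pnext ?mem_prev.
  by rewrite next_prev.
Qed.

(** The map sends [i] to the entry of [c] at position [i]. Edges are reflected because [c] has no
    chord. *)
Lemma cycle_iso : {f : 'I_(size c) -> G |
  [/\ injective f, f @: setT = [set x in c] &
      {mono f : i j / cycle_rel i j >-> i -- j}]}.
Proof.
have /andP[cyc un] := cycle_c.
have x0 : G by case: (c) size_c.
pose f (i : 'I_(size c)) := nth x0 c i.
have injf : injective f.
  by move=> i j /eqP; rewrite nth_uniq // => /eqP/val_inj.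
have fc i : f i \in c by rewrite mem_nth.
have fS i : f (ordS i) = next c (f i).
  by rewrite /f next_nth_mod.
exists f; split=> //.
  apply/setP=> x; rewrite inE; apply/imsetP/idP => [[i _ ->] //|xc].
  have ix : index x c < size c by rewrite index_mem.
  by exists (Ordinal ix); rewrite // /f nth_index.
move=> i j; rewrite /cycle_rel; apply/idP/idP.
  move=> ij; rewrite -(inj_eq injf) adj_neq //=.
  have [E|E] := cycle_chordless (fc i) (fc j) ij; apply/orP; [left|right];
    by rewrite -(inj_eq injf) fS E.
case/andP=> _ /orP[] /eqP->; rewrite fS ?[_ -- f j]edge_rel_sym;
  by rewrite next_cycle.
Qed.

(** * Longest outward paths and the induction *)

(** Listed from the far end, so that extending the path is consing; the suffix fixes its first step,
    from [x] to [y]. *)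
Definition outward_path S y x s :=
  [&& sorted adj s, uniq s, all (mem S) s & suffix [:: y; x] s].

Lemma longest_outward_path_leaf S y x z h p :
    x \in c -> y \notin c -> outward_path S y x [:: z, h & p] ->
    (forall s, outward_path S y x s -> size s <= size [:: z, h & p]) ->
  leaf_on S z h.
Proof.
move=> xc yc /and4P[pth un al suf] maxs.
have /and3P[zS hS _] := al; have /andP[zh _] := pth; split=> // w wS zw.
have [q Lq] := suffixP suf.
apply: (no_back_edge (esym Lq) xc yc pth un zw).
apply: contraT => whp; have := maxs (w :: [:: z, h & p]).
rewrite /= ltnn; apply; apply/and4P; split.
- by rewrite /= edge_rel_sym zw.
- by rewrite cons_uniq un inE negb_or whp eq_sym adj_neq.
- by rewrite /= wS.
- by apply/suffixP; exists (w :: q); rewrite Lq.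
Qed.

Definition realized S := exists H : cgraph,
  constructed H /\ exists f : H -> G, embedding f S.

Lemma realized_unicyclic S : {subset c <= S} -> cut_connected S -> ~ ke_on S ->
  realized S.
Proof.
have [n] := ubnP #|S|; elim: n S => // n IHn S; rewrite ltnS => leSn cS conS nke.
have IH (T : {set G}) v : v \in S -> T \subset S :\ v -> {subset c <= T} ->
    cut_connected T -> ~ ke_on T -> realized T.
  move=> vS TS; apply: IHn; apply: leq_trans leSn.
  by rewrite (cardsD1 v S) vS ltnS subset_leq_card.
have [Sc|Sc] := boolP (S \subset [set x in c]).
  have {Sc} Sc : S = [set x in c].
    by apply/eqP; rewrite eqEsubset Sc; apply/subsetP=> x; rewrite inE => /cS.
  have oddc : odd (size c).
    by apply: contraT => evc; case: nke; rewrite Sc; apply: even_cycle_ke.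
  have [f [fi fS fm]] := cycle_iso.
  exists (@CGraph (cycle_graph (size c)) (fun=> Blue)).
  by split; [apply: step_cycle | exists f; split=> //; rewrite fS].
have [||x [y [xc yS yc xy]]] := conS [set x in c].
- by move=> x; rewrite inE.
- by rewrite properE Sc andbT; apply/subsetP=> x; rewrite inE => /cS.
rewrite !inE in xc yc.
have P0 : outward_path S y x [:: y; x].
  apply/and4P; split; last exact: suffix_refl.
  - by rewrite /= edge_rel_sym xy.
  - by rewrite /= inE eq_sym adj_neq.
  - by rewrite /= yS cS.
have [|s Ps maxs] := ex_longest_seq P0 (n := #|G|).
  by move=> s /and4P[_ /uniq_size_leq].
case: s Ps maxs => [|z [|h p]] Ps maxs; try by have := maxs _ P0.
have lf := longest_outward_path_leaf xc yc Ps maxs.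
have [zS hS zh zlf] := lf; have zc := leaf_notin_cycle cS lf.
have hz : h != z by rewrite eq_sym adj_neq.
have cSz : {subset c <= S :\ z}.
  by move=> a ac; rewrite !inE cS // andbT; apply: contraNneq zc => <-.
have conSz := cut_connected_leaf lf conS.
have nkeSz : ~ ke_on (S :\ z :\ h) by move/(ke_on_leaf lf).
have /and4P[pth un al /suffixP[q Lq]] := Ps.
case: q Lq => [[? ? ?]|z' q [zz' Lq]].
  (* Here the path is the single edge from [x] to [y], so [h] is [x], and every cycle passes through
     [x]. *)
  subst z h p; case: nkeSz; apply: acyclic_ke_on => s sz cyc sS.
  have /sS : x \in s by rewrite (cycle_vertices sz cyc).
  by rewrite !inE eqxx.
case: p => [|k p] in Ps maxs pth un al Lq *.
  by case: q Lq => [|? []].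
have hk : h -- k by case/and3P: pth.
have [w /and4P[wS hw wz wk]|deg2] :=
    pickP [pred w | [&& w \in S, h -- w, w != z & w != k]].
  (* Replacing [z] by [w] gives an outward path of the same length; by [no_back_edge], [w] is not
     already on it. *)
  have lfw : leaf_on S w h.
    apply: (@longest_outward_path_leaf S y x w h (k :: p) xc yc _ maxs).
    case/andP: pth => _ pth; case/andP: un => _ un; case/andP: al => _ al.
    apply/and4P; split; last 1 first.
    - by apply/suffixP; exists (w :: q); rewrite Lq.
    - by rewrite /= edge_rel_sym hw.
    - rewrite cons_uniq; apply/andP; split; last exact: un.
      rewrite inE negb_or eq_sym adj_neq //=.
      apply: contra wk => wp; apply/eqP.
      exact: (no_back_edge (esym Lq) xc yc pth un hw).
    - by rewrite /= wS.
  have [|||||H [cH [f fE]]] := IH (S :\ z) z => //.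
    by move=> ke; apply/nke/(ke_on_twin_leaf _ lf lfw ke); rewrite eq_sym.
  have [fi fm fS] := fE.
  have /imsetP[a _ ha] : h \in f @: setT by rewrite fS !inE hz.
  have /imsetP[b _ wb] : w \in f @: setT by rewrite fS !inE wz.
  have [_ _ wh wlf] := lfw.
  subst h w; exists (add_colored_pendant a Black); split.
    (* The twin leaf [w] is still present as [b], whose only neighbour is [a]; so [a] is red. *)
    apply: step_leaf => //; apply: (constructed_leaf_red cH (x := b)).
      by rewrite -fm.
    move=> e be; apply: fi; apply: wlf; last by rewrite fm.
    have : f e \in f @: setT by apply: imset_f.
    by rewrite fS inE => /andP[].
  by exists (@pendant_extension _ a f z); apply: embedding_pendant.
have lfh : leaf_on (S :\ z) h k.
  have kS : k \in S by case/and4P: al.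
  have kz : k != z.
    by apply: contraTneq un => ->; rewrite /= !inE eqxx orbT.
  split; rewrite ?inE ?hz ?kz //.
  move=> w; rewrite !inE => /andP[wz wS] hw; apply/eqP.
  by move: (deg2 w); rewrite /= wS hw wz /= => /negbFE.
have hc := leaf_notin_cycle cSz lfh.
have [|||||H [cH [f fE]]] := IH (S :\ z :\ h) z => //.
- exact: subsetDl.
- by move=> a ac; rewrite inE cSz // andbT inE; apply: contraNneq hc => <-.
- exact: cut_connected_leaf lfh conSz.
have [fi fm fS] := fE.
have /imsetP[a _ ka] : k \in f @: setT.
  by have [_ kS hk' _] := lfh; rewrite fS inE kS andbT inE eq_sym adj_neq.
subst k.
exists (@add_colored_pendant (add_colored_pendant a Red) None Black).
split; first exact: step_path.
(* The inner new vertex, red, goes to [h], and the outer one, black, to [z]. *)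
exists (@pendant_extension (add_pendant a) None (@pendant_extension _ a f h) z).
by apply: embedding_pendant => //; apply: embedding_pendant.
Qed.

End Unicyclic.
End Graph.

(** * Application to the whole graph *)

(** A path from a vertex of [c] to one outside [T] must cross an edge leaving [T]. *)
Lemma connected_cut (G : sgraph) (c : seq G) : c != [::] -> connected_graph G ->
  cut_connected c setT.
Proof.
case: c => // x0 c _ conG T cT /properP[_ [y _ yT]].
have x0T : x0 \in T by apply: cT; rewrite inE eqxx.
have [/existsP[x /existsP[z /and3P[xT zT xz]]]|ncut] :=
    boolP [exists x, exists z, [&& x \in T, z \notin T & x -- z]].
  by exists x, z.
case/negP: yT; have/connectP[p pth ->] := conG x0 y.
elim: p x0 x0T {cT} pth => //= z p IHp x xT /andP[xz]; apply: IHp.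
apply: contraNT ncut => zT; apply/existsP; exists x; apply/existsP; exists z.
by rewrite xT zT.
Qed.

Theorem theorem4p9 (G : sgraph) :
  connected_graph G -> unicyclic G -> ~ konig_egervary G ->
  exists2 H : cgraph, constructed H & isomorphic G H.
Proof.
move=> conG [F [[c [sz cyc FE]] uniqF]] nke.
have cycle_unique s : 2 < size s -> ucycle (@edge_rel G) s ->
    cycle_edges s = cycle_edges c.
  by move=> szs cycs; rewrite -[RHS]FE; apply/esym/uniqF; exists s.
have [|||H [cH [f [fi fm fS]]]] :=
  realized_unicyclic sz cyc cycle_unique (S := setT).
- by move=> x; rewrite inE.
- by apply: connected_cut => //; case: (c) sz.
- by move/ke_onT.
have bijf : bijective f.
  apply: inj_card_bij fi _.
  by rewrite -[#|G|]cardsT -[#|H|]cardsT -fS leq_imset_card.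
have [g fK gK] := bijf.
exists H => //; exists g; first by exists f.
by move=> x y; rewrite -fm !gK.
Qed.
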